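(* Let $G=(V,E,\omega,\mu)$ be an infinite, locally finite, connected weighted graph with $\omega_{\min}>0$ and $D_\mu<\infty$, and let $T\in(0,\infty]$. Let $c,z:V\times[0,T)\to\mathbb R$ be such that $c$ and $z$ are bounded on $V\times I$ for every bounded interval $I\subset[0,T)$, and such that for each $x\in V$ the function $z(x,\cdot)$ is continuous on $[0,T)$ and differentiable on $(0,T)$ with $z_t(x,\cdot)$ continuous on $(0,T)$. If $$z_t-\Delta z-c(x,t)z\ge0\quad\text{for }(x,t)\in V\times(0,T),\qquad z(x,0)\ge0\quad\text{for }x\in V,$$ then $z\ge0$ on $V\times(0,T)$.
   Context: Weighted graph: $V$ is the vertex set, $E$ the edge set, $y\sim x$ means $xy\in E$; $\omega:V\times V\to[0,\infty)$ satisfies $\omega_{xy}=\omega_{yx}$ and $\omega_{xy}>0$ iff $x\sim y$; $\mu:V\to(0,\infty)$. Locally finite means every vertex has finitely many neighbours. Graphs have no loops and no multiple edges. $\omega_{\min}=\inf_{x\sim y}\omega_{xy}$, and $$\Delta u(x)=\frac1{\mu(x)}\sum_{y\sim x}\omega_{xy}(u(y)-u(x)),\qquad D_\mu=\sup_{x\in V}\frac{1}{\mu(x)}\sum_{y\sim x}\omega_{xy}.$$ $\Delta$ acts on the $x$ variable. *)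

(* Defs.v *)
From mathcomp Require Import all_boot all_order all_algebra.
From mathcomp Require Import all_classical all_reals all_analysis.
Set Implicit Arguments.
Unset Strict Implicit.
Unset Printing Implicit Defensive.
Import Order.TTheory GRing.Theory Num.Theory.
Import numFieldNormedType.Exports.
Local Open Scope classical_set_scope.
Local Open Scope ring_scope.

Record weighted_graph (R : realType) (V : choiceType) := WeightedGraph {
  adj : rel V;
  adj_sym : symmetric adj;
  adj_irr : irreflexive adj;
  weight : V -> V -> R;
  weight_ge0 : forall x y, 0 <= weight x y;
  weight_sym : forall x y, weight x y = weight y x;
  weight_gt0 : forall x y, 0 < weight x y <-> adj x y;
  vmeas : V -> R;
  vmeas_gt0 : forall x, 0 < vmeas x
}.

Section WeightedGraph.
Variables (R : realType) (V : choiceType) (G : weighted_graph R V).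

Definition nbrs (x : V) : set V := [set y | adj G x y].

Definition locally_finite : Prop := forall x, finite_set (nbrs x).

Definition graph_connected : Prop :=
  forall x y, exists2 p : seq V, path (adj G) x p & last x p = y.

(* The sums over [nbrs x] are finitely supported sums: they have the intended
   value when the graph is locally finite. *)
Definition laplacian (u : V -> R) (x : V) : R :=
  (vmeas G x)^-1 * \sum_(y \in nbrs x) (weight G x y * (u y - u x)).

Definition Dmu : \bar R :=
  ereal_sup [set ((vmeas G x)^-1 * \sum_(y \in nbrs x) weight G x y)%:E
            | x in [set: V]].

Definition weight_min : \bar R :=
  ereal_inf [set (weight G p.1 p.2)%:E | p in [set p : V * V | adj G p.1 p.2]].

End WeightedGraph.

(* The time intervals [0, T) and (0, T), where T may be +oo. *)
Definition time_co (R : realType) (T : \bar R) : set R :=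
  [set t | 0 <= t /\ (t%:E < T)%E].

Definition time_oo (R : realType) (T : \bar R) : set R :=
  [set t | 0 < t /\ (t%:E < T)%E].

(* Functions on V x [0, T) are represented by total functions on V x R whose
   values outside [0, T) are irrelevant.  For finite T, the interval I below
   may be [0, T) itself. *)
Definition bounded_on_bounded_intervals (R : realType) (V : Type)
    (T : \bar R) (f : V -> R -> R) : Prop :=
  forall I : set R, is_interval I -> bounded_set I -> I `<=` time_co T ->
  exists M : R, forall x t, I t -> `|f x t| <= M.

(* Main.v *)
Require Import Defs.
From mathcomp Require Import all_boot all_order all_algebra.
From mathcomp Require Import all_classical all_reals all_analysis.
From mathcomp Require Import ring lra.
Import Order.TTheory GRing.Theory Num.Theory.
Import numFieldNormedType.Exports.
Local Open Scope classical_set_scope.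
Local Open Scope ring_scope.

(** With [|c| <= K] on [[0, s]], consider [v = e^(-(K+1)t) z] and its infimum
    [m] over [V x [0, s]].  Let [v x] attain its minimum over [[0, s]] at [t].
    If [v x t < 0], then [t > 0] and [z_t <= (K+1) z] at [(x, t)], so the
    differential inequality gives [(1 + deg x) (v x t) >= deg x * m], whence
    [v >= D / (1 + D) * m] everywhere, as [deg x <= D := D_mu].  Thus [m >= D / (1 + D) * m], that is,
    [m >= 0]; no exhaustion of the graph is needed because [Delta] is bounded. *)

(** Left difference quotients at [t] have nonnegative numerator and negative denominator. Comparing
    on the left only admits a minimum at the right end of a time interval. *)
Lemma derive1_le0_of_left_min (R : realType) (f : R -> R) (a t : R) :
  a < t -> derivable f t 1 ->
  (forall s, a <= s <= t -> f t <= f s) -> derive1 f t <= 0.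
Proof.
move=> at_lt df fmin; rewrite derive1E.
apply: (@cvgr_to_le _ (0 : R)^'- _ R _ _ _ (cvg_dnbhs_at_left df)).
near=> h; apply: mulr_le0_ge0.
  by rewrite invr_le0; near: h; exact: nbhs_left_le.
rewrite subr_ge0 [_%:A]mulr1; apply: fmin => /=.
rewrite gerDr -lerBlDr; apply/andP; split; near: h.
  by apply: nbhs_left_ge; rewrite subr_lt0.
exact: nbhs_left_le.
Unshelve. all: by end_near. Qed.

Definition normalized_degree {R : realType} {V : choiceType}
    (G : weighted_graph R V) (x : V) : R :=
  (vmeas G x)^-1 * \sum_(y \in nbrs G x) weight G x y.

Lemma normalized_degree_ge0 (R : realType) (V : choiceType)
    (G : weighted_graph R V) (x : V) : 0 <= normalized_degree G x.
Proof.
rewrite mulr_ge0 ?invr_ge0 ?(ltW (vmeas_gt0 _ _))//.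
by apply: fsumr_ge0 => y _; exact: weight_ge0.
Qed.

Lemma normalized_degree_bounded (R : realType) (V : choiceType)
    (G : weighted_graph R V) : (Dmu G < +oo)%E ->
  exists2 D : R, 0 <= D & forall x, normalized_degree G x <= D.
Proof.
move=> Dfin.
have degD x : ((normalized_degree G x)%:E <= Dmu G)%E.
  by apply: ereal_sup_ubound; exists x.
case: (Dmu G) Dfin degD => [D _ degD| // |_ degD]; last first.
  (* Here [Dmu G] is [-oo], which any vertex [x] contradicts: the vertex set is empty. *)
  by exists 0 => // x; have := degD x; rewrite leeNy_eq.
exists (Num.max 0 D); first by rewrite le_max lexx.
by move=> x; rewrite le_max -[X in _ || X]lee_fin degD orbT.
Qed.

(** Weights are nonnegative, so lowering each [u y] to [b] lowers the sum term by term; local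
    finiteness makes both sums genuine finite sums. *)
Lemma laplacian_ge (R : realType) (V : choiceType) (G : weighted_graph R V)
    (u : V -> R) (b : R) (x : V) :
  locally_finite G -> (forall y, b <= u y) ->
  normalized_degree G x * (b - u x) <= laplacian G u x.
Proof.
move=> Glf bu; rewrite /normalized_degree /laplacian -mulrA.
rewrite ler_wpM2l ?invr_ge0 ?(ltW (vmeas_gt0 _ _))//.
rewrite mulr_fsuml !fsbig_finite; try exact: Glf.
apply: ler_sum => y _.
by rewrite ler_wpM2l ?weight_ge0// lerD2r.
Qed.

Lemma derive1_expR_scale (R : realType) (l t : R) (f : R -> R) :
  derivable f t 1 ->
  derivable (fun s => expR (- l * s) * f s) t 1 /\
  derive1 (fun s => expR (- l * s) * f s) t =
    expR (- l * t) * (derive1 f t - l * f t).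
Proof.
move=> /derivableP df.
have dl : is_derive t (1 : R) (fun s : R => - l * s) (- l).
  have := is_deriveZ (- l) (is_derive_id t (1 : R)).
  by rewrite /GRing.scale /= mulr1.
have de := is_derive1_comp (is_derive_expR (- l * t)) dl.
have dv := is_deriveM de df.
split; first exact: (@ex_derive _ _ _ _ _ _ _ dv).
rewrite !derive1E; have -> : (fun s => expR (- l * s) * f s) =
  (expR \o (fun s => - l * s)) * f by [].
rewrite (@derive_val _ _ _ _ _ _ _ dv) /= /GRing.scale /=; ring.
Qed.

(** If [v < 0], then [k * v <= v], so [d / (1 + d) * m <= v]; as [d / (1 + d)] increases with [d]
    and [m <= 0], passing to [D] only weakens this bound. If [0 <= v], the signs suffice. *)
Lemma minimum_contraction (R : realFieldType) (D d m k v : R) :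
  0 <= d -> d <= D -> m <= 0 -> 1 <= k -> d * (m - v) <= k * v ->
  D / (1 + D) * m <= v.
Proof.
move=> d0 dD m0 k1 H.
have D1 : 0 < 1 + D by lra.
rewrite mulrAC ler_pdivrMr//.
have [v0|v0] := leP 0 v; first by nra.
have H1 : d * m <= (1 + d) * v by nra.
have H2 : d * m * (1 + D) <= (1 + d) * v * (1 + D) by rewrite ler_pM2r.
have H3 : (1 + d) * (D * m) <= (1 + d) * (v * (1 + D)) by nra.
by move: H3; rewrite ler_pM2l//; lra.
Qed.

Section Supersolution.
Variables (R : realType) (V : choiceType) (G : weighted_graph R V).
Variables (s K D : R) (c z : V -> R -> R).
Hypothesis Glf : locally_finite G.
Hypothesis s_ge0 : 0 <= s.
Hypothesis D_ge0 : 0 <= D.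
Hypothesis degD : forall x, normalized_degree G x <= D.
Hypothesis z_cont : forall x, {within `[0, s], continuous (z x)}.
Hypothesis z_diff : forall x t, 0 < t <= s -> derivable (z x) t 1.
Hypothesis c_le : forall x t, 0 <= t <= s -> c x t <= K.
Hypothesis z_super : forall x t, 0 < t <= s ->
  0 <= derive1 (z x) t - laplacian G (fun y => z y t) x - c x t * z x t.
Hypothesis z_init : forall x, 0 <= z x 0.

(** The extra [1] in the rate gives [K + 1 - c >= 1], which is what keeps the contraction factor
    below 1. *)
Let v (x : V) (t : R) : R := expR (- (K + 1) * t) * z x t.

Lemma damped_lower_bound_contraction (m : R) : m <= 0 ->
  (forall x t, 0 <= t <= s -> m <= v x t) ->
  forall x t, 0 <= t <= s -> D / (1 + D) * m <= v x t.
Proof.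
move=> m0 mv x t0 t0s.
have vcont : {within `[0, s], continuous (v x)}.
  move=> r; apply: (@continuousM _ (subspace `[0, s])
    (fun t : R => expR (- (K + 1) * t)) (z x) r); last exact: z_cont.
  apply: (@continuous_subspaceT _ _ _ (fun t : R => expR (- (K + 1) * t))).
  move=> q; apply: (@continuous_comp _ _ _ (fun t : R => - (K + 1) * t) expR).
    exact: mulrl_continuous.
  exact: continuous_expR.
have [t + tmin] := EVT_min s_ge0 vcont.
rewrite in_itv /= => /andP[t_ge0 t_les].
apply: (@le_trans _ _ (v x t)); last by apply: tmin; rewrite in_itv.
have e0 : 0 < expR (- (K + 1) * t) := expR_gt0 _.
have qm0 : D / (1 + D) * m <= 0.
  by apply: mulr_ge0_le0 => //; rewrite divr_ge0// addr_ge0.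
(* A minimum at time 0 is nonnegative by the initial condition, hence above the nonpositive
   target. *)
have [t_le0|t_gt0] := leP t 0.
  have -> : t = 0 by apply/eqP; rewrite eq_le t_le0.
  by apply: (le_trans qm0); rewrite /v mulr_ge0 ?expR_ge0.
have ts : 0 < t <= s by rewrite t_gt0.
have [dv dvE] := derive1_expR_scale _ (K + 1) _ _ (z_diff x _ ts).
have : derive1 (v x) t <= 0.
  apply: (@derive1_le0_of_left_min _ _ 0) => // r /andP[r0 rt].
  by apply: tmin; rewrite in_itv /= r0 (le_trans rt).
rewrite /v dvE pmulr_rle0// => dz_le.
have lap := laplacian_ge _ _ G (fun y => z y t)
  (m / expR (- (K + 1) * t)) x Glf _.
have {}lap : normalized_degree G x * (m / expR (- (K + 1) * t) - z x t)
    <= laplacian G (fun y => z y t) x.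
  by apply: lap => y; rewrite ler_pdivrMr// mulrC; apply: mv; rewrite t_ge0.
have cK : c x t <= K by apply: c_le; rewrite t_ge0.
have sup := z_super x _ ts.
apply: (@minimum_contraction _ _ (normalized_degree G x) _ (K + 1 - c x t)) => //.
- exact: normalized_degree_ge0.
- lra.
(* The left side is at most the Laplacian, which is at most [z_t - c z], and [z_t <= (K + 1) z] by
   [dz_le]. Multiplying by the exponential then returns to [v]. *)
have H : normalized_degree G x * (m / expR (- (K + 1) * t) - z x t)
    <= (K + 1 - c x t) * z x t by lra.
rewrite -(ler_pM2l e0) in H.
have E : m = expR (- (K + 1) * t) * (m / expR (- (K + 1) * t)).
  by rewrite mulrC divfK// gt_eqF.
rewrite [m in X in X <= _]E -mulrBr; lra.
Qed.

Lemma supersolution_ge0 (M : R) :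
  (forall x t, 0 <= t <= s -> `|z x t| <= M) ->
  0 <= K + 1 -> forall x t, 0 <= t <= s -> 0 <= z x t.
Proof.
move=> zM K0 x t ts.
pose E := [set r | exists y, exists2 q, 0 <= q <= s & r = v y q].
have vE y q : 0 <= q <= s -> E (v y q) by move=> qs; exists y, q.
have lbE : has_lbound E.
  (* The exponential lies in [(0, 1]] since [0 <= K + 1], and [M >= 0], so damping cannot push [z]
     below [- M]. *)
  exists (- M) => _ [y [q qs ->]]; have := zM y q qs; rewrite ler_norml.
  move=> /andP[zl zr].
  have e0 := expR_gt0 (- (K + 1) * q).
  have e1 : expR (- (K + 1) * q) <= 1.
    by case/andP: qs => q0 _; rewrite -[leRHS]expR0 ler_expR mulNr oppr_le0 mulr_ge0.
  rewrite /v; nra.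
have mv y q : 0 <= q <= s -> inf E <= v y q.
  by move=> qs; apply: ge_inf => //; exact: vE.
suff m0 : 0 <= inf E.
  by have := le_trans m0 (mv x t ts); rewrite /v pmulr_rge0 ?expR_gt0.
rewrite leNgt; apply/negP => m0.
have : D / (1 + D) * inf E <= inf E.
  apply: lb_le_inf; first by exists (v x t); exact: vE.
  move=> _ [y [q qs ->]]; exact: (damped_lower_bound_contraction _ (ltW m0)).
(* Clearing the denominator gives [D * inf E <= (1 + D) * inf E], impossible for [inf E < 0]. *)
have D1 : 0 < 1 + D by rewrite ltr_wpDr.
by rewrite mulrAC ler_pdivrMr// => qm; nra.
Qed.

End Supersolution.

Theorem lemma3p2 (R : realType) (V : choiceType) (G : weighted_graph R V)
  (Vinf : infinite_set [set: V])
  (Glf : locally_finite G)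
  (Gconn : graph_connected G)
  (wmin_gt0 : (0 < weight_min G)%E)
  (Dmu_fin : (Dmu G < +oo)%E)
  (T : \bar R) (T_gt0 : (0 < T)%E)
  (c z : V -> R -> R)
  (c_bnd : bounded_on_bounded_intervals T c)
  (z_bnd : bounded_on_bounded_intervals T z)
  (z_cont : forall x, {within time_co T, continuous (z x)})
  (z_diff : forall x t, time_oo T t -> derivable (z x) t 1)
  (zt_cont : forall x, {within time_oo T, continuous (derive1 (z x))})
  (z_super : forall x t, time_oo T t ->
     0 <= derive1 (z x) t - laplacian G (fun y => z y t) x - c x t * z x t)
  (z_init : forall x, 0 <= z x 0) :
  forall x t, time_oo T t -> 0 <= z x t.
Proof.
move=> x s [s_gt0 sT].
(* The time in question serves as right endpoint: as [s < T], the bounds on [[0, s]] are uniform and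
   [z] is differentiable at [s] itself. *)
have sub_co : `[0, s] `<=` time_co T.
  move=> t /=; rewrite in_itv /= => /andP[t0 ts]; split=> //.
  by apply: le_lt_trans sT; rewrite lee_fin.
have sub_oo t : 0 < t <= s -> time_oo T t.
  move=> /andP[t0 ts]; split=> //.
  by apply: le_lt_trans sT; rewrite lee_fin.
have itv0s : is_interval `[0, s] by exact: interval_is_interval.
have bnd0s : bounded_set [set` `[0, s]].
  by apply: compact_bounded; exact: segment_compact.
have [K cK] := c_bnd _ itv0s bnd0s sub_co.
have [M zM] := z_bnd _ itv0s bnd0s sub_co.
have [D D0 degD] := normalized_degree_bounded _ _ _ Dmu_fin.
have in0s t : 0 <= t <= s -> [set` `[0, s]] t by rewrite /= in_itv.
have s_s : 0 <= s <= s by rewrite lexx ltW.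
(* [K] bounds an absolute value at the given vertex [x]. *)
have K0 : 0 <= K by apply: le_trans (cK x s _) => //; exact: in0s.
have K1 : 0 <= K + 1 by rewrite addr_ge0.
apply: (@supersolution_ge0 _ _ G s K D c z _ _ _ degD _ _ _ _ _ M) => //.
- exact: ltW.
- by move=> y; apply: continuous_subspaceW (z_cont y).
- by move=> y t ts; apply: z_diff; exact: sub_oo.
- by move=> y t ts; apply: le_trans (ler_norm _) (cK y t _); exact: in0s.
- by move=> y t ts; apply: z_super; exact: sub_oo.
Qed.
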